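(* Let $n\in\mathbb{N}_0$ and let $A\subseteq\mathbb{R}^{2n}$ be a countably $n$-rectifiable and $n$-negligible subset. Then there exists a linear function $H:\mathbb{R}^{2n}\to\mathbb{R}$ such that for almost every $t\in\mathbb{R}$ (with respect to one-dimensional Lebesgue measure) we have \[\varphi_H^t(A)\cap A=\emptyset,\] where $\varphi_H^t$ denotes the Hamiltonian time-$t$ flow of $H$ with respect to the standard symplectic form $\omega^{\mathrm{st}}$ on $\mathbb{R}^{2n}$.
   Context: $\mathbb{N}_0=\{0,1,2,\ldots\}$. $\mathbb{R}^{\ell}$ carries the Euclidean distance, and subsets carry the restricted distance. Let $(X,d)$ be a metric space and $s\in[0,\infty)$. $X$ is called $s$-negligible iff for every $\varepsilon\in(0,\infty)$ there exists a countable collection $\mathcal{S}$ of subsets of $X$ covering $X$ such that $\sum_{S\in\mathcal{S}}(\operatorname{diam}S)^s<\varepsilon$, with the convention $0^0:=1$. (Equivalently, the $s$-dimensional outer Hausdorff measure of $X$ vanishes.) For $m\in\mathbb{N}_0$, $X$ is called countably $m$-rectifiable iff there exists a countable (possibly empty or finite) set $\mathcal{F}$ of Lipschitz maps with domains given by subsets of $\mathbb{R}^m$ and target $X$, such that $X=\bigcup_{f\in\mathcal{F}}\operatorname{im}(f)$. The Hamiltonian vector field $X_H$ of $H$ is defined by $\iota_{X_H}\omega^{\mathrm{st}}=dH$, and $\varphi_H^t$ is its flow. For linear $H$ it is globally defined for all times. *)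

(* Defs.v *)
From HB Require Import structures.
From mathcomp Require Export all_boot all_order all_algebra.
From mathcomp Require Export all_classical all_reals all_analysis.

Set Implicit Arguments.
Unset Strict Implicit.
Unset Printing Implicit Defensive.

Export Order.TTheory GRing.Theory Num.Theory.
Export numFieldNormedType.Exports.

Local Open Scope classical_set_scope.
Local Open Scope ring_scope.

(* A metric space is given below as a subset A of a type T together with a
   distance d on T, to be restricted to A. Matrices carry the sup norm in the
   library, hence the separate Euclidean distance (the two induce the same
   topology, so the library's derivatives can still be used). *)
Definition euclid_dist (R : realType) (l : nat) (x y : 'rV[R]_l) : R :=
  Num.sqrt (\sum_(i < l) (x ord0 i - y ord0 i) ^+ 2).

(* Taking the maximum with 0 only matters for diam set0 = 0. *)
Definition diam (R : realType) (T : Type) (d : T -> T -> R) (B : set T)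
    : \bar R :=
  maxe 0%E (ereal_sup [set (d xy.1 xy.2)%:E | xy in B `*` B]).

(* `poweR` satisfies x `^ 0 = 1 for all x, in particular for x = 0. The
   collection C may be finite or empty. *)
Definition negligible_dim (R : realType) (T : Type) (d : T -> T -> R)
    (A : set T) (s : R) : Prop :=
  forall eps : R, 0 < eps ->
    exists C : set (set T),
      [/\ countable C,
          (forall B, C B -> B `<=` A),
          A `<=` \bigcup_(B in C) B
        & (\esum_(B in C) poweR (diam d B) s < eps%:E)%E].

Definition lipschitz_on (R : realType) (S T : Type) (dS : S -> S -> R)
    (dT : T -> T -> R) (D : set S) (f : S -> T) : Prop :=
  exists L : R, forall x y, D x -> D y -> dT (f x) (f y) <= L * dS x y.

(* A map D -> A with D a subset of R^m is encoded by a pair (D, f) with f total;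
   the values of f outside D are irrelevant. *)
Definition countably_rectifiable (R : realType) (T : Type) (d : T -> T -> R)
    (m : nat) (A : set T) : Prop :=
  exists F : set (set 'rV[R]_m * ('rV[R]_m -> T)),
    [/\ countable F,
        (forall g, F g -> g.2 @` g.1 `<=` A
                          /\ lipschitz_on (@euclid_dist R m) d g.1 g.2)
      & A = \bigcup_(g in F) (g.2 @` g.1)].

(* R^(2n) has coordinates (q_1, ..., q_n, p_1, ..., p_n), and
   omega_st = \sum_i dq_i /\ dp_i. *)
Definition omega_st (R : realType) (n : nat) (u v : 'rV[R]_(n + n)) : R :=
  \sum_(i < n) (u ord0 (lshift n i) * v ord0 (rshift n i)
                - u ord0 (rshift n i) * v ord0 (lshift n i)).

Definition is_hamiltonian_vf (R : realType) (n : nat) (H : 'rV[R]_(n + n) -> R)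
    (X : 'rV[R]_(n + n) -> 'rV[R]_(n + n)) : Prop :=
  forall x, differentiable H x /\ forall v, omega_st (X x) v = 'd H x v.

(* Global flows only. *)
Definition is_hamiltonian_flow (R : realType) (n : nat)
    (H : 'rV[R]_(n + n) -> R)
    (phi : R -> 'rV[R]_(n + n) -> 'rV[R]_(n + n)) : Prop :=
  exists2 X, is_hamiltonian_vf H X &
    forall x, phi 0 x = x /\
      forall t : R, is_derive t (1 : R) (phi ^~ x) (X (phi t x)).

(* Main.v *)
(* A linear Hamiltonian generates the translations x |-> x + t v, and every
   direction v arises this way. So it suffices to find v such that t v lies in
   A - A for almost no t.

   The difference set is 2n-negligible: if A is covered by sets B_k of diameters
   at most r_k with small sum of the r_k^n, and f is an L-Lipschitz map on a
   bounded subset of R^n, then cut the domain of f into about r_k^(-n) cells of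
   size r_k. On each of them f - B_k has diameter O(r_k), so that f - A is
   covered by sets whose 2n-th powers of diameters sum up to
   O(sum_k r_k^(-n) r_k^(2n)) = O(sum_k r_k^n).

   For x_0 <> 0 the slopes x = (x_0, w) |-> x_0 (1, w) are locally
   bi-Lipschitz, so the set of those x with x_0 (1, w) in A - A is negligible
   too. Tonelli's theorem, applied to one coordinate at a time, yields a w for
   which the slice in x_0 is a null set; take v = (1, w). *)
From HB Require Import structures.
Require Import Defs.
From mathcomp Require Import measurable_realfun ring lra zify.

Set Implicit Arguments.
Unset Strict Implicit.
Unset Printing Implicit Defensive.

Local Open Scope classical_set_scope.
Local Open Scope ring_scope.

(** * Linear Hamiltonians and translations *)

Lemma omega_st_linear (R : realType) (n : nat) (u : 'rV[R]_(n + n)) :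
  scalar (omega_st u).
Proof.
move=> a x y; rewrite /omega_st /GRing.scale /= mulr_sumr -big_split /=.
by apply: eq_bigr => i _; rewrite !mxE; ring.
Qed.

Lemma omega_st_continuous (R : realType) (n : nat) (u : 'rV[R]_(n + n)) :
  continuous (omega_st u).
Proof.
have cM (a : R) j : continuous (fun y : 'rV[R]_(n + n) => a * y ord0 j).
  move=> x; apply: continuousM; first exact: cst_continuous.
  exact: coord_continuous.
pose f i (y : 'rV[R]_(n + n)) := u ord0 (lshift n i) * y ord0 (rshift n i).
pose g i (y : 'rV[R]_(n + n)) := u ord0 (rshift n i) * y ord0 (lshift n i).
have cF i : continuous (fun y => f i y - g i y).
  by move=> x; apply: (@continuousB _ _ _ (f i) (g i)); exact: cM.
move=> x; apply: (@cvg_big _ _ _ _ _ _ _ _ _ (fun i y => f i y - g i y)) => [||i _].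
- exact: add_continuous.
- exact: nbhs_filter.
- exact: cF.
Qed.

Lemma omega_st_delta_rshift (R : realType) (n : nat) (u : 'rV[R]_(n + n)) i :
  omega_st u (delta_mx ord0 (rshift n i)) = u ord0 (lshift n i).
Proof.
rewrite /omega_st (bigD1 i) //= big1 => [|j ji]; rewrite !mxE eq_lrshift.
  by rewrite !eqxx mulr0 mulr1 subr0 addr0.
by rewrite (inj_eq (@rshift_inj _ _)) (negbTE ji) !mulr0 subr0.
Qed.

Lemma omega_st_delta_lshift (R : realType) (n : nat) (u : 'rV[R]_(n + n)) i :
  omega_st u (delta_mx ord0 (lshift n i)) = - u ord0 (rshift n i).
Proof.
rewrite /omega_st (bigD1 i) //= big1 => [|j ji]; rewrite !mxE eq_rlshift.
  by rewrite !eqxx mulr0 mulr1 sub0r addr0.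
by rewrite (inj_eq (@lshift_inj _ _)) (negbTE ji) !mulr0 subr0.
Qed.

(** Nondegeneracy: pairing with the basis vectors reads off all coordinates up to sign. This makes
    the Hamiltonian vector field unique. *)
Lemma omega_st_inj (R : realType) (n : nat) (u v : 'rV[R]_(n + n)) :
  omega_st u =1 omega_st v -> u = v.
Proof.
move=> uv; apply/rowP => k; rewrite -(splitK k); case: (fintype.split k) => i /=.
- by have := uv (delta_mx ord0 (rshift n i)); rewrite !omega_st_delta_rshift.
- have := uv (delta_mx ord0 (lshift n i)); rewrite !omega_st_delta_lshift.
  exact: oppr_inj.
Qed.

Lemma is_derive_translation (R : realType) (n : nat) (v x : 'rV[R]_n) (t : R) :
  is_derive t (1 : R) (fun s : R => x + s *: v) v.
Proof.
have Dc i j : is_derive t (1 : R) (fun s : R => (x + s *: v) i j) (v i j).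
  have -> : (fun s : R => (x + s *: v) i j) = cst (x i j) + (v i j \*: id).
    by apply/funext => s; rewrite !mxE !fctE mulrC.
  apply: is_derive_eq (is_deriveD (is_derive_cst _ _ _)
    (is_deriveZ _ (is_derive_id _ _))) _.
  by rewrite add0r [LHS]mulr1.
have dv : derivable (fun s : R => x + s *: v) t (1 : R).
  by apply/derivable_mxP => i j; exact: ex_derive.
split => //; rewrite derive_mx //; apply/matrixP => i j.
by rewrite mxE; exact: derive_val.
Qed.

(** Each coordinate of [f t - t v] has derivative zero on the whole line. This gives uniqueness of
    the flow. *)
Lemma derive_const_translation (R : realType) (n : nat) (v : 'rV[R]_n)
    (f : R -> 'rV[R]_n) :
  (forall t : R, is_derive t (1 : R) f v) -> forall t, f t = f 0 + t *: v.
Proof.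
move=> df t; apply/rowP => j; rewrite !mxE.
pose h := (fun s => f s 0 j) - (v 0 j \*: @id R).
have dh s : is_derive s (1 : R) h 0.
  have [dfs fs] := df s.
  have fj : is_derive s (1 : R) (fun s => f s 0 j) (v 0 j).
    by split; [exact: (derivable_mxP f s 1).1 dfs 0 j|rewrite -fs derive_mx // mxE].
  apply: is_derive_eq (is_deriveB fj (is_deriveZ _ (is_derive_id _ _))) _.
  by rewrite [X in _ - X]mulr1 subrr.
have hE s : h s = f s 0 j - s * v 0 j by rewrite mulrC.
have := is_derive_0_is_cst t 0 dh; rewrite !hE mul0r subr0 => <-.
by rewrite subrK.
Qed.

Lemma translation_hamiltonian_flow (R : realType) (n : nat)
    (v : 'rV[R]_(n + n)) :
  exists H : {scalar 'rV[R]_(n + n)},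
    unique (is_hamiltonian_flow H) (fun t x => x + t *: v).
Proof.
(* Contracting the form with [v] gives a linear function, which is its own differential; its
   Hamiltonian vector field is constantly [v]. *)
pose H : {scalar 'rV[R]_(n + n)} := HB.pack (omega_st v)
  (GRing.isLinear.Build _ _ _ _ _ (omega_st_linear v)).
have Hc : continuous H by exact: omega_st_continuous.
have dH x : 'd H x = H :> (_ -> _) by exact: diff_lin.
exists H; split.
  exists (fun=> v).
    by move=> x; split=> [|w]; [exact: linear_differentiable|rewrite dH].
  by move=> x; rewrite scale0r addr0; split => // t; exact: is_derive_translation.
move=> phi [X HX Hphi].
have {HX}Xv x : X x = v.
  by apply: omega_st_inj => w; have [_ ->] := HX x; rewrite dH.
apply/funext => t; apply/funext => x; have [phi0 dphi] := Hphi x.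
have dphiv s : is_derive s (1 : R) (phi ^~ x) v by rewrite -(Xv (phi s x)).
by have := derive_const_translation dphiv t; rewrite phi0 => ->.
Qed.

(** * Sets negligible with respect to covers by cubes *)

(* R^m is modelled by sequences of which only the first m coordinates matter. *)
Definition cube_cover (R : realType) (m : nat) (Z : set (nat -> R))
    (e : \bar R) : Prop :=
  exists (c : nat -> nat -> R) (r : nat -> R),
    [/\ forall k, 0 <= r k,
        forall x, Z x -> exists k, forall i, (i < m)%N -> `|x i - c k i| <= r k
      & (\sum_(k <oo) (r k ^+ m)%:E <= e)%E].

(** For [m > 0] this is Lebesgue nullity of the projection to the first [m] coordinates: a cube has
    volume [(2 r)^m], and the factor [2^m] is harmless. *)
Definition cube_null (R : realType) (m : nat) (Z : set (nat -> R)) : Prop :=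
  forall e : R, 0 < e -> cube_cover m Z e%:E.

Lemma cube_cover_bigcup (R : realType) (m : nat) (Z : nat -> set (nat -> R))
    (e : nat -> \bar R) :
  (forall k, cube_cover m (Z k) (e k)) ->
  cube_cover m (\bigcup_k Z k) (\sum_(k <oo) e k)%E.
Proof.
move=> /choice[c] /choice[r] H.
have /card_esym/ppcard_eqP[f] := card_nat2.
pose a (p : nat * nat) := (r p.1 p.2 ^+ m)%:E.
have a0 p : (0 <= a p)%E.
  by rewrite lee_fin exprn_ge0 //; have [r0 _ _] := H p.1; exact: r0.
exists (fun k => c (f k).1 (f k).2), (fun k => r (f k).1 (f k).2); split.
- by move=> k; have [r0 _ _] := H (f k).1; exact: r0.
- move=> x [k _ Zx]; have [_ /(_ _ Zx)[l Hl] _] := H k.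
  by exists (f^-1%FUN (k, l)); rewrite invK ?inE.
(* Rearranging the nonnegative terms along the bijection [f] turns the single series into an
   iterated one. *)
- rewrite (nneseries_esumT (a := fun k => a (f k))) // -(reindex_esum setT setT f a) //.
  rewrite (_ : setT = [set: nat] `*`` (fun=> [set: nat])); last first.
    by apply/seteqP; split => // -[].
  rewrite -(esum_esum (a := fun k l => a (k, l))) //.
  rewrite -nneseries_esumT; last by move=> k; exact: esum_ge0.
  apply: lee_nneseries => [k _ _|k _]; first exact: esum_ge0.
  by rewrite -nneseries_esumT //; have [_ _] := H k.
Qed.

Lemma cube_coverS (R : realType) (m : nat) (Y Z : set (nat -> R)) (d e : \bar R) :
  Y `<=` Z -> (d <= e)%E -> cube_cover m Z d -> cube_cover m Y e.
Proof.
move=> YZ de [c [r [r0 H rd]]]; exists c, r; split=> //.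
  by move=> x /YZ/H.
exact: le_trans de.
Qed.

Lemma cube_nullS (R : realType) (m : nat) (Y Z : set (nat -> R)) :
  Y `<=` Z -> cube_null m Z -> cube_null m Y.
Proof. by move=> YZ Z0 e e0; exact: cube_coverS (Z0 _ e0). Qed.

Lemma cube_null_bigcup (R : realType) (m : nat) (Z : nat -> set (nat -> R)) :
  (forall k, cube_null m (Z k)) -> cube_null m (\bigcup_k Z k).
Proof.
move=> Z0 e e0.
have := @cube_cover_bigcup _ m Z (fun k => (e / (2 ^ k.+1)%:R)%:E).
move=> /(_ (fun k => Z0 k _ _)) H.
apply: cube_coverS (H _) => // [|k]; last by rewrite divr_gt0.
exact: epsilon_trick0 (ltW e0).
Qed.

(** Each nonempty [Y j] lies in the cube of half side [r] around any of its points. Cubes of radius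
    0 complete the sequence; they cost nothing, the exponent being positive. *)
Lemma cube_cover_fin (R : realType) (m : nat) (I : finType)
    (Y : I -> set (nat -> R)) (r : R) : 0 <= r ->
  (forall j x y, Y j x -> Y j y ->
    forall i, (i < m.+1)%N -> `|x i - y i| <= r) ->
  cube_cover m.+1 (\bigcup_j Y j) (#|I|%:R * r ^+ m.+1)%:E.
Proof.
move=> r0 H.
have /choice[c Hc] : forall j, exists c, forall x, Y j x ->
    forall i, (i < m.+1)%N -> `|x i - c i| <= r.
  move=> j; have [[y Yy]|Yj] := pselect (Y j !=set0).
    by exists y => x Yx; exact: H Yx Yy.
  by exists (fun=> 0) => x Yx; case: Yj; exists x.
pose s := enum I.
exists (fun k => if (k < size s)%N then nth (fun=> 0) (map c s) k else fun=> 0).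
exists (fun k => if (k < size s)%N then r else 0); split => [k|x [j _ Yx]|].
- by case: ifP.
- have js : (index j s < size s)%N by rewrite index_mem mem_enum.
  by exists (index j s); rewrite js (nth_map j) // nth_index ?mem_enum //; exact: Hc.
- rewrite (nneseries_split 0 (size s)) //; last first.
    by move=> k _; rewrite lee_fin exprn_ge0 //; case: ifP.
  rewrite add0n [X in (_ + X)%E]eseries0 ?adde0; last first.
    by move=> k sk _; rewrite ltnNge sk /= expr0n.
  rewrite (eq_big_nat _ _ (F2 := fun=> (r ^+ m.+1)%:E)); last first.
    by move=> k /andP[_ ->].
  by rewrite sumEFin lee_fin sumr_const_nat subn0 -cardE mulr_natl.
Qed.

Lemma lebesgue_measure_centered_itv (R : realType) (c r : R) : 0 <= r ->
  lebesgue_measure `[c - r, c + r]%classic = (r *+ 2)%:E.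
Proof.
move=> r0; rewrite lebesgue_measure_itv /= lte_fin.
case: ltP => h; first by rewrite -EFinB; congr EFin; ring.
have -> : r = 0 by apply/eqP; rewrite eq_le r0 andbT; lra.
by rewrite mul0rn.
Qed.

(** Tonelli on covers: a cube of half side [r] meets the slice at [w] in a cube of the same half
    side or not at all, and integrating [r^(m+1)] over the former [w] gives [2 r^(m+2)]. Covers with
    summable totals thus have, for some [w], slices with summable totals, and these become
    arbitrarily small. *)
Lemma cube_null_slice (R : realType) (m : nat) (Z : set (nat -> R)) :
  cube_null m.+2 Z ->
  exists w, cube_null m.+1 [set x | Z (fun i => if i == m.+1 then w else x i)].
Proof.
move=> Z0.
have /choice[c /choice[r H]] : forall j, cube_cover m.+2 Z (1 / (2 ^ j.+1)%:R)%:E.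
  by move=> j; apply: Z0; rewrite divr_gt0.
have r0 j k : 0 <= r j k by have [+ _ _] := H j; exact.
pose D j k : set R := `[c j k m.+1 - r j k, c j k m.+1 + r j k]%classic.
pose g j k (w : R) : \bar R := ((r j k ^+ m.+1)%:E * (\1_(D j k) w : R)%:E)%E.
have g0 j k w : (0 <= g j k w)%E by rewrite mule_ge0 ?lee_fin ?exprn_ge0.
have mD j k : measurable (D j k) by exact: measurable_itv.
have m1D j k : measurable_fun setT (fun w : R => (\1_(D j k) w : R)%:E).
  by apply/measurable_EFinP; exact: measurable_indic.
have mg j k : measurable_fun setT (g j k) by exact: measurable_funeM.
have intg j k : (\int[lebesgue_measure]_w g j k w = (r j k ^+ m.+2 *+ 2)%:E)%E.
  rewrite ge0_integralZl //.
  - rewrite integral_indic; last exact: mD.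
    rewrite setIT [X in (_ * X)%E](lebesgue_measure_centered_itv _ (r0 j k)).
    by rewrite -EFinM mulrnAr -exprSr.
  - exact: measurableT.
  - exact: m1D.
  - by rewrite lee_fin exprn_ge0.
pose G w := (\sum_(j <oo) \sum_(k <oo) g j k w)%E.
have mG' j : measurable_fun setT (fun w => \sum_(k <oo) g j k w)%E.
  by apply: ge0_emeasurable_sum.
have G'0 j w : (0 <= \sum_(k <oo) g j k w)%E by exact: nneseries_ge0.
have mG : measurable_fun setT G by apply: ge0_emeasurable_sum.
have intG : (\int[lebesgue_measure]_w G w <= 2%:E)%E.
  rewrite integral_nneseries //.
  apply: (@le_trans _ _ (\sum_(j <oo) (2 / (2 ^ j.+1)%:R)%:E)%E); last first.
    exact: epsilon_trick0.
  apply: lee_nneseries => [j _ _|j _]; first exact: integral_ge0.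
  rewrite integral_nneseries //; last exact: mg.
  rewrite (eq_eseriesr (g := fun k => (2%:E * (r j k ^+ m.+2)%:E)%E)); last first.
    by move=> k _; rewrite intg -EFinM mulr_natl.
  rewrite nneseriesZl; last by move=> k _; rewrite lee_fin exprn_ge0.
  rewrite -[2 in leRHS]mulr1 -mulrA EFinM.
  by apply: lee_wpmul2l; rewrite ?lee_fin //; have [_ _] := H j.
have Gint : lebesgue_measure.-integrable setT G.
  apply/integrableP; split; first exact: mG.
  rewrite [X in (X < _)%E](_ : _ = \int[lebesgue_measure]_w G w)%E.
    exact: le_lt_trans intG (ltry _).
  by apply: eq_integral => w _; rewrite gee0_abs // nneseries_ge0.
(* An integrable function is finite almost everywhere, and the line has positive measure. *)
have [w Gw] : exists w, G w \is a fin_num.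
  have := integrable_ae measurableT Gint.
  have muT : (0 < (lebesgue_measure : set R -> \bar R) setT)%E.
    by rewrite -set_itvNyy lebesgue_measure_itv /= ltry.
  move=> aeG; have := @filter_ex _ _ (ae_properfilter_algebraOfSetsType muT) _ aeG.
  by move=> [w /(_ I)]; exists w.
exists w => e e0.
(* Otherwise every term of the outer series exceeds [e], and [N] of them outgrow the finite value
   [G w]. *)
have [j Gj] : exists j, (\sum_(k <oo) g j k w <= e%:E)%E.
  apply: contrapT => /forallNP Ge.
  have G0 : 0 <= fine (G w) by rewrite fine_ge0 // nneseries_ge0.
  pose N := Num.bound (fine (G w) / e).
  have : ((N%:R * e)%:E <= G w)%E.
    apply: le_trans (nneseries_lim_ge N _) => //.
    rewrite -[N in leLHS]subn0 mulr_natl -sumr_const_nat -sumEFin.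
    by apply: lee_sum => j _; rewrite ltW // ltNge; apply/negP/Ge.
  rewrite -(fineK Gw) lee_fin -ler_pdivlMr //.
  by rewrite leNgt archi_boundP // divr_ge0 // ltW.
(* Cubes that miss the slice shrink to radius 0. *)
exists (c j), (fun k => r j k * \1_(D j k) w); split => [k|x Zx|].
- by rewrite mulr_ge0.
- have [_ /(_ _ Zx)[k Hk] _] := H j; exists k => i im.
  have Dw : D j k w.
    have := Hk m.+1 (ltnSn _); rewrite eqxx /D /= in_itv /= ler_distl.
    by [].
  rewrite indicE mem_set // mulr1.
  by have := Hk i (ltnW im); rewrite ltn_eqF.
- apply: le_trans Gj; apply: lee_nneseries => [k _ _|k _].
    by rewrite lee_fin exprn_ge0 // mulr_ge0.
  rewrite /g -EFinM lee_fin exprMn indicE.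
  by case: (_ \in _); rewrite ?expr1n ?expr0n.
Qed.

(** Slicing fixes the last coordinates one after another, until only coordinate 0 is free. *)
Lemma cube_null_line (R : realType) (m : nat) (Z : set (nat -> R)) :
  cube_null m.+1 Z -> exists w : nat -> R,
    cube_null 1 [set x | Z (fun i => if i == 0%N then x 0%N else w i)].
Proof.
elim: m Z => [|m IH] Z Z0.
  exists (fun=> 0) => e /Z0[c [r [r0 H rd]]]; exists c, r; split=> // x /= /H[k Hk].
  by exists k => -[|//] _; exact: (Hk 0%N).
have [a /IH[w Hw]] := cube_null_slice Z0.
exists (fun i => if i == m.+1 then a else w i).
apply: cube_nullS Hw => x /=; congr Z; apply/funext => i.
by case: i => //= i; case: eqP.
Qed.

(** Each cover gives a union of closed intervals; intersecting these unions over covers of ever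
    smaller total length yields a measurable null hull. *)
Lemma cube_null1_negligible (R : realType) (Z : set (nat -> R)) :
  cube_null 1 Z -> lebesgue_measure.-negligible [set x 0%N | x in Z].
Proof.
move=> Z0.
have /choice[c /choice[r H]] : forall j, cube_cover 1 Z j.+1%:R^-1%:E.
  by move=> j; apply: Z0; rewrite invr_gt0.
have r0 j k : 0 <= r j k by have [+ _ _] := H j; exact.
pose D j k : set R := `[c j k 0%N - r j k, c j k 0%N + r j k]%classic.
have mD j k : measurable (D j k) by exact: measurable_itv.
have mU j : measurable (\bigcup_k D j k) by exact: bigcupT_measurable.
exists (\bigcap_j \bigcup_k D j k); split.
- exact: bigcapT_measurable.
- apply/eqP; rewrite eq_le measure_ge0 andbT; apply/lee_addgt0Pr => e e0.
  rewrite add0e.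
  pose j := Num.bound (2 / e).
  have sub : (lebesgue_measure (\bigcap_j \bigcup_k D j k) <=
              \sum_(k <oo) lebesgue_measure (D j k))%E.
    apply: measure_sigma_subadditive; first by move=> k; exact: mD.
      exact: bigcapT_measurable.
    exact: bigcap_inf.
  apply: (le_trans sub).
  apply: (@le_trans _ _ (\sum_(k <oo) (2%:E * (r j k ^+ 1)%:E))%E).
    apply: lee_nneseries => // k _.
    by rewrite [leLHS](lebesgue_measure_centered_itv _ (r0 j k)) expr1 -EFinM mulr_natl.
  rewrite nneseriesZl; last by move=> k _; rewrite lee_fin expr1.
  have [_ _ Hj] := H j.
  apply: (le_trans (lee_wpmul2l _ Hj)) => //.
  rewrite -EFinM lee_fin ler_pdivrMr // mulrC -ler_pdivrMr //.
  by rewrite (le_trans (ltW (archi_boundP _))) ?ler_nat // divr_ge0 // ltW.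
- move=> _ [x Zx <-] j _; have [_ /(_ _ Zx)[k Hk] _] := H j.
  by exists k => //; have := Hk 0%N isT; rewrite /D /= in_itv /= ler_distl.
Qed.

(** * Differences of a rectifiable and a negligible set *)

Lemma diam_ge0 (R : realType) (T : Type) (d : T -> T -> R) (B : set T) :
  (0 <= diam d B)%E.
Proof. by rewrite le_max lexx. Qed.

Lemma le_diam (R : realType) (T : Type) (d : T -> T -> R) (B : set T) x y :
  B x -> B y -> ((d x y)%:E <= diam d B)%E.
Proof.
by move=> Bx By; rewrite le_max ereal_sup_ubound ?orbT //; exists (x, y).
Qed.

(** The radii are made positive and at most 1 because their inverses will determine the mesh of a
    grid. *)
Lemma negligible_dim_cover (R : realType) (T : Type) (d : T -> T -> R)
    (A : set T) (n : nat) (eps : R) :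
  negligible_dim d A n.+1%:R -> 0 < eps ->
  exists (B : nat -> set T) (rho : nat -> R),
    [/\ forall k, 0 < rho k <= 1,
        forall k x y, B k x -> B k y -> d x y <= rho k,
        A `<=` \bigcup_k B k
      & (\sum_(k <oo) (rho k ^+ n.+1)%:E <= eps%:E)%E].
Proof.
(* One [e] pays for the given diameters, a second for enlarging them; the bound 1 on the total keeps
   each radius at most 1. *)
move=> A0 eps0; pose e := Num.min eps 1 / 2.
have e0 : 0 < e by rewrite divr_gt0 // lt_min eps0 ltr01.
have [C [cC _ AC Ce]] := A0 _ e0.
(* [E] is injective on [P], so no set is counted twice. *)
have /countable_bijP[P /card_esym/pcard_eqP/bijPex[E [EC injE surjE]]] := cC.
have imE : C = E @` P by apply/seteqP; split => // _ [k Pk <-]; exact: EC.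
pose p (B : set T) := poweR (diam d B) n.+1%:R.
have p0 B : (0 <= p B)%E by exact: poweR_ge0.
have sumE : (\sum_(k <oo | k \in P) p (E k) < e%:E)%E.
  by rewrite -esum_set_image // -imE.
(* An infinite diameter would make the sum infinite, the exponent being positive. *)
have fin k : k \in P -> diam d (E k) \is a fin_num.
  move=> Pk; rewrite ge0_fin_numE ?diam_ge0 // ltey; apply/eqP => Dy.
  by move: sumE; rewrite (nneseries_pinfty (k := k)) // /p Dy poweRyr ?pnatr_eq0.
pose B k := if k \in P then E k else set0.
pose del k := if k \in P then fine (diam d (E k)) else 0.
have del0 k : 0 <= del k by rewrite /del; case: ifP => // _; rewrite fine_ge0 ?diam_ge0.
have sumd : (\sum_(k <oo) (del k ^+ n.+1)%:E <= e%:E)%E.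
  apply: le_trans (ltW sumE); rewrite [leRHS]eseries_mkcond.
  apply: lee_nneseries => k _; first by rewrite lee_fin exprn_ge0.
  rewrite /del; case: ifPn => Pk; last by rewrite expr0n.
  rewrite /p -[X in poweR X _](fineK (fin _ Pk)) poweR_EFin.
  by rewrite powR_mulrn ?fine_ge0 ?diam_ge0.
(* The geometric term makes the radius positive even if the set is empty or a point. *)
pose t k := del k ^+ n.+1 + e / (2 ^ k.+1)%:R.
have t0 k : 0 < t k by rewrite ltr_wpDl ?exprn_ge0 // divr_gt0.
pose rho k := t k `^ n.+1%:R^-1.
have rhoX k : rho k ^+ n.+1 = t k.
  by rewrite -powR_mulrn ?powR_ge0 // -powRrM mulVf ?pnatr_eq0 // powRr1 // ltW.
have rho0 k : 0 < rho k by exact: powR_gt0.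
have sumr : (\sum_(k <oo) (rho k ^+ n.+1)%:E <= (e + e)%:E)%E.
  rewrite (eq_eseriesr (g := fun k => (del k ^+ n.+1)%:E + (e / (2 ^ k.+1)%:R)%:E)%E).
    by apply: le_trans (epsilon_trick _ _ (ltW e0)) _ => [k|];
      rewrite ?lee_fin ?exprn_ge0 // EFinD leeD2r.
  by move=> k _; rewrite rhoX.
have ee : e + e = Num.min eps 1 by rewrite /e; field.
exists B, rho; split.
- move=> k; rewrite rho0 /=.
  rewrite -(@ler_pXn2r _ n.+1) // ?nnegrE ?(ltW (rho0 k)) // expr1n -lee_fin.
  apply: le_trans (le_trans _ sumr) _; last by rewrite ee lee_fin ge_min lexx orbT.
  have r0 i : (0 <= (rho i ^+ n.+1)%:E)%E by rewrite lee_fin exprn_ge0 ?ltW.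
  by rewrite (nneseriesD1 (n := k)) // leeDl // nneseries_ge0.
- move=> k x y; rewrite /B; case: ifPn => // Pk Ex Ey.
  apply: (@le_trans _ _ (del k)).
    by rewrite /del Pk -lee_fin fineK ?fin // le_diam.
  rewrite -(@ler_pXn2r _ n.+1) // ?nnegrE ?(ltW (rho0 _)) // rhoX lerDl.
  by rewrite divr_ge0 // ltW.
- move=> x /AC[b Cb bx]; move: Cb; rewrite imE => -[k Pk Ek].
  by exists k => //; rewrite /B mem_set // Ek.
- by apply: le_trans sumr _; rewrite ee lee_fin ge_min lexx.
Qed.

Lemma euclid_dist_ge0 (R : realType) (l : nat) (x y : 'rV[R]_l) :
  0 <= euclid_dist x y.
Proof. exact: sqrtr_ge0. Qed.

Lemma le_coord_euclid_dist (R : realType) (l : nat) (x y : 'rV[R]_l) i :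
  `|x ord0 i - y ord0 i| <= euclid_dist x y.
Proof.
rewrite -sqrtr_sqr ler_sqrt ?sumr_ge0 //; last by move=> j _; exact: sqr_ge0.
by rewrite (bigD1 i) //= lerDl sumr_ge0 // => j _; exact: sqr_ge0.
Qed.

(** The crude factor [l] replaces its square root, by [l <= l^2]. *)
Lemma euclid_dist_le (R : realType) (l : nat) (x y : 'rV[R]_l) (e : R) :
  0 <= e -> (forall i, `|x ord0 i - y ord0 i| <= e) ->
  euclid_dist x y <= l%:R * e.
Proof.
move=> e0 H; have le0 : 0 <= l%:R * e by rewrite mulr_ge0.
rewrite -[leRHS](ger0_norm le0) -sqrtr_sqr ler_sqrt ?sqr_ge0 //.
apply: (@le_trans _ _ (\sum_(i < l) e ^+ 2)).
  by apply: ler_sum => i _; rewrite -[leLHS]real_normK ?num_real // lerXn2r ?nnegrE.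
rewrite sumr_const card_ord -[leLHS]mulr_natl exprMn ler_wpM2r ?sqr_ge0 //.
by rewrite -natrX ler_nat; case: (l) => // k; rewrite leq_pmulr.
Qed.

(** A cell records the integer parts of [q (x_i + M)]. They run from 0 to [2 M q], the top value
    occurring at [x_i = M], hence the successor. *)
Lemma grid_cells (R : realType) (n M q : nat) : (0 < q)%N ->
  exists cell : 'rV[R]_n -> {ffun 'I_n -> 'I_(2 * M * q).+1},
    forall x y : 'rV[R]_n, (forall i, `|x ord0 i| <= M%:R) ->
      (forall i, `|y ord0 i| <= M%:R) -> cell x = cell y ->
      forall i, `|x ord0 i - y ord0 i| <= q%:R^-1.
Proof.
move=> q0; have q0R : 0 < q%:R :> R by rewrite ltr0n.
pose h (x : 'rV[R]_n) i := q%:R * (x ord0 i + M%:R).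
exists (fun x => [ffun i => inord (Num.truncn (h x i))]) => x y xM yM /ffunP cxy i.
have hb (z : 'rV[R]_n) : (forall i, `|z ord0 i| <= M%:R) ->
    0 <= h z i /\ (Num.truncn (h z i) < (2 * M * q).+1)%N.
  move=> /(_ i); rewrite ler_norml => /andP[z1 z2].
  split; first by rewrite mulr_ge0 //; lra.
  rewrite ltnS truncn_le_nat // -natr1 ltr_pwDr //.
  rewrite !natrM mulrC ler_wpM2l //; lra.
have [[hx0 hx] [hy0 hy]] := (hb _ xM, hb _ yM).
have := cxy i; rewrite !ffunE => /(congr1 val); rewrite /= !inordK // => hxy.
have := truncn_itv hx0; have := truncn_itv hy0; rewrite hxy.
move=> /andP[y1 y2] /andP[x1 x2].
rewrite -(ler_pM2l q0R) divff ?gt_eqF // -(ger0_norm (ltW q0R)) -normrM.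
have -> : q%:R * (x ord0 i - y ord0 i) = h x i - h y i by rewrite /h; ring.
by rewrite -natr1 in x2 y2; rewrite ler_norml; apply/andP; split; lra.
Qed.

(** Coordinate 0 of [x] is left free to hold the time by which the vector is scaled, so that one
    sequence encodes both time and direction. *)
Definition slope_vector (R : realType) (m : nat) (x : nat -> R) : 'rV[R]_m :=
  \row_i (if i == 0%N :> nat then 1 else x i).

(** Away from time 0, time and slopes are Lipschitz functions of the scaled vector: its coordinate 0
    is the time, and division by it recovers the slopes. *)
Lemma slope_coord_dist (R : realType) (m : nat) (M s : R) (x y : nat -> R) :
  1 <= M -> 0 <= s -> M^-1 <= `|x 0%N| ->
  (forall i, (i < m)%N -> `|y i| <= M) ->
  (forall i, `|(x 0%N *: slope_vector m x) ord0 i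
               - (y 0%N *: slope_vector m y) ord0 i| <= s) ->
  forall i, (i < m)%N -> `|x i - y i| <= 2 * M ^+ 2 * s.
Proof.
move=> M1 s0 xM yM H.
have M0 : 0 < M by apply: lt_le_trans M1.
have MM : M <= M ^+ 2 by rewrite expr2 ler_peMl // ltW.
have H0 i : (i < m)%N -> `|x 0%N - y 0%N| <= s.
  case: m H {yM} => // m H _.
  by have := H ord0; rewrite !mxE !mulr1.
move=> i im; have sM : s <= 2 * M ^+ 2 * s by rewrite ler_peMl //; nra.
have [->|i0] := eqVneq i 0%N; first exact: le_trans (H0 _ im) sM.
have := H (Ordinal im); rewrite !mxE /= (negbTE i0) => Hi.
have xy : `|x 0%N| * `|x i - y i| <= s + M * s.
  rewrite -normrM.
  have -> : x 0%N * (x i - y i) =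
    (x 0%N * x i - y 0%N * y i) - (x 0%N - y 0%N) * y i by ring.
  apply: le_trans (ler_normB _ _) _; rewrite lerD // normrM mulrC.
  by rewrite ler_pM // ?yM // (H0 _ im).
have : M^-1 * `|x i - y i| <= s + M * s.
  by apply: le_trans xy; rewrite ler_wpM2r.
rewrite mulrC ler_pdivrMr // => /le_trans; apply.
(* The bound reached is [M (1 + M) s], and [M <= M^2]. *)
have : 0 <= s * (M ^+ 2 - M) by rewrite mulr_ge0 // subr_ge0.
by nra.
Qed.

(** The bound [M] confines [y] to a cube that a finite grid can cut, and keeps the time away from 0.
    The grid is chosen for each [B k] separately, with mesh comparable to [rho k]. *)
Lemma cube_null_slopes (R : realType) (n : nat) (A : set 'rV[R]_(n.+1 + n.+1))
    (D : set 'rV[R]_n.+1) (f : 'rV[R]_n.+1 -> 'rV[R]_(n.+1 + n.+1)) (M : nat) :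
  (0 < M)%N ->
  negligible_dim (@euclid_dist R (n.+1 + n.+1)) A n.+1%:R ->
  lipschitz_on (@euclid_dist R n.+1) (@euclid_dist R (n.+1 + n.+1)) D f ->
  cube_null (n.+1 + n.+1) [set x : nat -> R |
    [/\ M%:R^-1 <= `|x 0%N|,
        forall i, (i < n.+1 + n.+1)%N -> `|x i| <= M%:R
      & exists y a, [/\ D y, forall i, `|y ord0 i| <= M%:R, A a
          & x 0%N *: slope_vector (n.+1 + n.+1) x = f y - a]]].
Proof.
move=> M0 A0 [L0 fL0] eps eps0.
have M1 : 1 <= M%:R :> R by rewrite ler1n.
pose L := Num.max L0 0.
have Lge0 : 0 <= L by rewrite le_max lexx orbT.
have fL x y : D x -> D y -> euclid_dist (f x) (f y) <= L * euclid_dist x y.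
  move=> Dx Dy; apply: le_trans (fL0 _ _ Dx Dy) _.
  by rewrite ler_wpM2r ?euclid_dist_ge0 // le_max lexx.
(* Points of one cell have images within [L (n+1) rho k], points of [B k] are within [rho k], and
   recovering time and slopes costs the factor [2 M^2]. *)
pose K := 2 * M%:R ^+ 2 * (L * n.+1%:R + 1).
have K0 : 0 < K.
  by rewrite mulr_gt0 ?ltr_wpDl ?mulr_ge0 // mulr_gt0 ?exprn_gt0 ?ltr0n.
(* With at most [6 M / rho k] cells per axis, [(6 M / rho k)^(n+1) (K rho k)^(2n+2) = c (rho
   k)^(n+1)]. *)
pose c := (6 * M%:R * K ^+ 2) ^+ n.+1.
have c0 : 0 < c by rewrite exprn_gt0 // mulr_gt0 ?exprn_gt0 // mulr_gt0 ?ltr0n.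
have [B [rho [rho01 dB AB sumrho]]] := negligible_dim_cover A0 (divr_gt0 eps0 c0).
have rho0 k : 0 < rho k by have /andP[] := rho01 k.
have rho1 k : rho k <= 1 by have /andP[] := rho01 k.
(* The mesh [1 / q k] is at most [rho k], while [q k <= 2 / rho k] because [rho k <= 1]. *)
pose q k := (Num.truncn (rho k)^-1).+1.
have q1 k : (q k)%:R^-1 <= rho k.
  by rewrite -[leRHS]invrK lef_pV2 ?posrE ?invr_gt0 ?ltr0n // ltW // truncnS_gt.
have q2 k : (q k)%:R <= 2 / rho k.
  have : (Num.truncn (rho k)^-1)%:R <= (rho k)^-1.
    by rewrite truncn_le // invr_ge0 ltW.
  have : 1 <= (rho k)^-1 by rewrite invf_ge1.
  rewrite /q -natr1; lra.
have gridk k := @grid_cells R n.+1 M (q k) isT.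
pose cell k := projT1 (cid (gridk k)); have Hcell k := projT2 (cid (gridk k)).
pose Y k j := [set x : nat -> R |
  [/\ M%:R^-1 <= `|x 0%N|,
      forall i, (i < n.+1 + n.+1)%N -> `|x i| <= M%:R
    & exists y a, [/\ D y, forall i, `|y ord0 i| <= M%:R, B k a, cell k y = j
        & x 0%N *: slope_vector (n.+1 + n.+1) x = f y - a]]].
have diamY k j x x' : Y k j x -> Y k j x' ->
    forall i, (i < n.+1 + n.+1)%N -> `|x i - x' i| <= K * rho k.
  move=> [x0 xM [y [a [Dy yM Ba cy xE]]]] [_ xM' [y' [a' [Dy' yM' Ba' cy' xE']]]].
  move=> i im; rewrite /K -mulrA.
  apply: (slope_coord_dist _ _ x0 xM') im => //.
    by rewrite mulr_ge0 ?(ltW (rho0 _)) // addr_ge0 // mulr_ge0.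
  move=> {}i; rewrite xE xE' !mxE.
  have -> : f y ord0 i - a ord0 i - (f y' ord0 i - a' ord0 i) =
    (f y ord0 i - f y' ord0 i) - (a ord0 i - a' ord0 i) by ring.
  apply: le_trans (ler_normB _ _) _; rewrite mulrDl mul1r lerD //.
    apply: le_trans (le_coord_euclid_dist _ _ _) _.
    apply: le_trans (fL _ _ Dy Dy') _; rewrite -mulrA ler_wpM2l //.
    apply: euclid_dist_le; first exact: ltW.
    move=> {}i; apply: le_trans (q1 k).
    exact: (Hcell k _ _ yM yM' (etrans cy (esym cy'))).
  apply: le_trans (le_coord_euclid_dist _ _ _) _.
  exact: dB Ba Ba'.
have coverY k : cube_cover (n.+1 + n.+1) (\bigcup_j Y k j) (c%:E * (rho k ^+ n.+1)%:E)%E.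
  have Kr : 0 <= K * rho k by rewrite mulr_ge0 // ltW.
  apply: cube_coverS (cube_cover_fin (m := n + n.+1) Kr (@diamY k)) => //.
  rewrite -EFinM lee_fin card_ffun !card_ord natrX -addSn exprD -exprMn.
  have KK : 0 <= K * rho k * (K * rho k) by exact: mulr_ge0.
  have cr : 0 <= 6 * M%:R * K ^+ 2 * rho k.
    by apply: mulr_ge0; [apply: mulr_ge0; rewrite ?sqr_ge0 ?mulr_ge0|exact: ltW].
  rewrite -!exprMn lerXn2r ?nnegrE //; first exact: mulr_ge0.
  (* Since [M q k >= 1], the left side is at most [3 M q k]. *)
  have qM : (2 * M * q k).+1%:R <= 6 * M%:R / rho k.
    apply: (@le_trans _ _ (3 * M * q k)%:R); last first.
      rewrite natrM (_ : 6 * _ / _ = (3 * M)%:R * (2 / rho k)) ?ler_wpM2l //.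
      by rewrite natrM; field; rewrite gt_eqF.
    have : (0 < M * q k)%N by rewrite muln_gt0 M0.
    by rewrite ler_nat -!mulnA; lia.
  apply: le_trans (ler_wpM2r _ qM) _; first exact: KK.
  by rewrite le_eqVlt; apply/orP; left; apply/eqP; field; rewrite gt_eqF.
have := cube_cover_bigcup coverY.
apply: cube_coverS.
  move=> x [x0 xM [y [a [Dy yM Aa xE]]]].
  have [k _ Ba] := AB _ Aa.
  by exists k => //; exists (cell k y) => //; split => //; exists y, a.
rewrite nneseriesZl; last by move=> k _; rewrite lee_fin exprn_ge0 ?ltW.
apply: (le_trans (lee_wpmul2l _ sumrho)); first by rewrite lee_fin ltW.
by rewrite -EFinM lee_fin mulrC divfK // gt_eqF.
Qed.

(** * Displacing directions *)

(** By [0^0 = 1] each covering set contributes 1, so a total below 1 leaves no covering set. *)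
Lemma negligible_dim0 (R : realType) (T : Type) (d : T -> T -> R) (A : set T) :
  negligible_dim d A 0 -> A = set0.
Proof.
move=> /(_ 1 ltr01)[C [_ _ AC C1]]; apply/seteqP; split => // a /AC[B CB _].
move: C1; rewrite ltNge => /negP; apply.
apply: esum_ge; exists [set B]; first by split=> // _ ->.
by rewrite fsbig_set1 poweRe0.
Qed.

(** The set is a countable union over the Lipschitz pieces [g] covering [A] and the integer bounds
    [M]. *)
Lemma cube_null_differences (R : realType) (n : nat)
    (A : set 'rV[R]_(n.+1 + n.+1)) :
  countably_rectifiable (@euclid_dist R (n.+1 + n.+1)) n.+1 A ->
  negligible_dim (@euclid_dist R (n.+1 + n.+1)) A n.+1%:R ->
  cube_null (n.+1 + n.+1) [set x : nat -> R | x 0%N != 0 /\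
    exists b a, [/\ A b, A a & x 0%N *: slope_vector (n.+1 + n.+1) x = b - a]].
Proof.
move=> [F [cF HF AF]] A0.
pose W (g : set 'rV[R]_n.+1 * ('rV[R]_n.+1 -> 'rV[R]_(n.+1 + n.+1))) (M : nat) :=
  [set x : nat -> R |
    [/\ M%:R^-1 <= `|x 0%N|,
        forall i, (i < n.+1 + n.+1)%N -> `|x i| <= M%:R
      & exists y a, [/\ g.1 y, forall i, `|y ord0 i| <= M%:R, A a
          & x 0%N *: slope_vector (n.+1 + n.+1) x = g.2 y - a]]].
(* An empty family has no enumeration by the naturals; in that case [A] is empty. *)
have [F0|[g]] := pfcard_geP cF.
  have A_0 : A = set0 by rewrite AF F0 bigcup_set0.
  apply: (@cube_nullS _ _ _ (\bigcup_(k : nat) set0)).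
    by move=> x /= [_ [b [a []]]]; rewrite A_0.
  apply: cube_null_bigcup => _ e e0.
  exists (fun _ _ => 0), (fun=> 0); split=> //.
  by rewrite eseries0 ?lee_fin ?ltW // => k _ _; rewrite expr0n.
apply: (@cube_nullS _ _ _ (\bigcup_k \bigcup_M W (g k) M.+1)); last first.
  apply: cube_null_bigcup => k; apply: cube_null_bigcup => M.
  apply: cube_null_slopes => //.
  by have [] := HF (g k) (funS _ (I : [set: nat] k)).
move=> x /= [x0 [b [a [Ab Aa xba]]]].
move: Ab; rewrite {1}AF => -[h Fh [y hy yb]].
have [k _ gk] := surj (f := g) Fh.
(* A common bound for [1 / |x_0|], all [|x_i|] and all [|y_i|]; the next integer serves as [M]. *)
pose s := `|x 0%N|^-1 + \sum_(i < n.+1 + n.+1) `|x i| + \sum_(i < n.+1) `|y ord0 i|.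
have sX : 0 <= \sum_(i < n.+1 + n.+1) `|x i| by rewrite sumr_ge0.
have sY : 0 <= \sum_(i < n.+1) `|y ord0 i| by rewrite sumr_ge0.
have x0i : 0 < `|x 0%N|^-1 by rewrite invr_gt0 normr_gt0.
have sM : s <= (Num.truncn s).+1%:R by rewrite ltW // truncnS_gt.
exists k => //; exists (Num.truncn s) => //; split.
- rewrite -[leRHS]invrK lef_pV2 ?posrE //; apply: le_trans sM; rewrite /s; lra.
- move=> i im; have : `|x i| <= \sum_(i < n.+1 + n.+1) `|x i|.
    by rewrite (bigD1 (Ordinal im)) //= lerDl sumr_ge0.
  by move=> xi; apply: le_trans sM; rewrite /s; lra.
- exists y, a; rewrite gk; split => //; last by rewrite yb.
  move=> i; have : `|y ord0 i| <= \sum_(i < n.+1) `|y ord0 i|.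
    by rewrite (bigD1 i) //= lerDl sumr_ge0.
  by move=> xi; apply: le_trans sM; rewrite /s; lra.
Qed.

Lemma exists_displacing_direction (R : realType) (n : nat)
    (A : set 'rV[R]_(n + n)) :
  countably_rectifiable (@euclid_dist R (n + n)) n A ->
  negligible_dim (@euclid_dist R (n + n)) A n%:R ->
  exists v : 'rV[R]_(n + n),
    {ae (@lebesgue_measure R), forall t : R,
      [set x + t *: v | x in A] `&` A = set0}.
Proof.
case: n A => [|n] A Arect Aneg.
  (* For [n = 0] the set [A] is empty. *)
  by exists 0; apply: aeW => t; rewrite (negligible_dim0 Aneg) setI0.
have [w Hw] := cube_null_line (m := n + n.+1) (cube_null_differences Arect Aneg).
exists (slope_vector _ w).
(* Time 0, excluded from the slopes, is added as a null set. At any other bad time [t], [t v] is a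
   difference of points of [A]. *)
have N0 : lebesgue_measure.-negligible [set 0 : R].
  by exists [set 0]; split => //; exact: lebesgue_measure_set1.
apply: negligibleS (negligibleU (cube_null1_negligible Hw) N0) => t /=.
move=> /eqP/set0P[b [[a Aa ab] Ab]].
have [->|t0] := eqVneq t 0; [by right|left].
exists (fun=> t) => //=; split => //; exists b, a; split => //.
rewrite -ab addrC addKr; congr (_ *: _).
by apply/rowP => i; rewrite !mxE; case: eqP.
Qed.

Theorem corollary8 (R : realType) (n : nat) (A : set 'rV[R]_(n + n))
    (Arect : countably_rectifiable (@euclid_dist R (n + n)) n A)
    (Aneg : negligible_dim (@euclid_dist R (n + n)) A n%:R) :
  exists (H : {scalar 'rV[R]_(n + n)})
         (phi : R -> 'rV[R]_(n + n) -> 'rV[R]_(n + n)),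
    unique (is_hamiltonian_flow H) phi /\
    {ae (@lebesgue_measure R), forall t : R, phi t @` A `&` A = set0}.
Proof.
have [v Av] := exists_displacing_direction Arect Aneg.
have [H HH] := translation_hamiltonian_flow v.
by exists H, (fun t x => x + t *: v).
Qed.
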